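(* Let $0\le\gamma<1$, $\alpha=\frac{4}{3+\gamma}$, let $\Omega\subset\mathbb{R}^n$ be a bounded smooth domain and $\varphi\ge0$ a smooth boundary datum. There exists $\epsilon>0$ depending only on the dimension $n$ such that the following holds. Let $u$ be a limit Perron's solution of the problem $$\Delta_\infty u=u^{-\gamma}\ \text{ in }\Omega\cap\{u>0\},\qquad u=\varphi\ \text{ on }\partial\Omega ,$$ and let $\Omega'\Subset\Omega$. Let $c>0$ be the nondegeneracy constant (depending only on $\gamma$), so that $\sup_{B_r(x)}u\ge c\,r^\alpha$ for all $x\in\overline{\{u>0\}}\cap\Omega$ and $0<r\le\frac12\mathrm{dist}(x,\partial\Omega)$, and let $C,r_0>0$ be the optimal growth constants for $\Omega'$, so that $\sup_{B_r(x)}u\le C\,r^\alpha$ for all $x\in\partial\{u>0\}\cap\Omega'$ and $0<r\le r_0$. Then for each $$0<\tau<\min\left\{\tfrac12,\left(\tfrac{c}{C}\right)^{\frac1\alpha}\right\}$$ one has $$\mathcal{H}^{\,n-\epsilon\tau^n}\left(\partial\{u>0\}\cap\Omega'\right)<\infty ,$$ where $\mathcal{H}^s$ denotes the $s$-dimensional Hausdorff measure.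
   Context: $\Delta_\infty u=\sum_{i,j}D_{ij}u\,D_iu\,D_ju$, understood in the viscosity sense. Fix $\delta=\frac12\alpha^{-4/(3+\gamma)}$ and a Lipschitz function $\mathcal{B}:\mathbb{R}\to\mathbb{R}$ with $0\le\mathcal{B}\le1$, $\mathcal{B}(s)=0$ for $s\le\delta/2$ and $\mathcal{B}(s)=1$ for $s\ge\delta$. For $\varepsilon>0$ put $\mathcal{B}_\varepsilon(s)=\mathcal{B}(s/\varepsilon^\alpha)$; the expression $\mathcal{B}_\varepsilon(s)s^{-\gamma}$ is taken to be $0$ for $s\le\frac{\delta}{2}\varepsilon^\alpha$. The penalized problem $(P_\varepsilon)$ is $$\Delta_\infty u=\mathcal{B}_\varepsilon(u)\,u^{-\gamma}\ \text{ in }\Omega,\qquad u=\varphi\ \text{ on }\partial\Omega .$$ Let $\underline u,\overline u\in C(\overline\Omega)$ be the viscosity solutions of $\Delta_\infty\underline u=(\delta/2)^{-\gamma}\varepsilon^{-\alpha\gamma}$ and $\Delta_\infty\overline u=0$ in $\Omega$ with $\underline u=\overline u=\varphi$ on $\partial\Omega$. The minimal (Perron) solution of $(P_\varepsilon)$ is $$u_\varepsilon(x)=\inf\{w(x): w\in C(\overline\Omega)\text{ is a viscosity supersolution of }(P_\varepsilon),\ \underline u\le w\le\overline u\text{ in }\overline\Omega\},$$ where a viscosity supersolution satisfies $\Delta_\infty w\le\mathcal{B}_\varepsilon(w)w^{-\gamma}$ in the viscosity sense; $u_\varepsilon$ is a nonnegative continuous viscosity solution of $(P_\varepsilon)$.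 A limit Perron's solution is a function $u$ on $\Omega$ that is the limit, uniformly on compact subsets of $\Omega$, of minimal solutions $u_{\varepsilon_k}$ for some sequence $\varepsilon_k\to0^+$. The set $\partial\{u>0\}$ is the boundary of $\{u>0\}$ within $\Omega$. *)

(* Defs.v *)
From mathcomp Require Import all_boot all_order all_algebra.
From mathcomp Require Import all_classical all_reals all_analysis.

Set Implicit Arguments.
Unset Strict Implicit.
Unset Printing Implicit Defensive.

Import Order.TTheory GRing.Theory Num.Theory.
Import numFieldNormedType.Exports.

Local Open Scope classical_set_scope.
Local Open Scope ring_scope.

(* The normed-module structure of 'rV[R]_n carries the sup norm.  Topological
   notions (open, closure, compact, continuity, derivatives) do not depend on
   the norm and are taken from the library; balls, distances and diameters are
   Euclidean and defined here. *)

Definition eucl_norm (R : realType) (n : nat) (x : 'rV[R]_n) : R :=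
  Num.sqrt (\sum_(i < n) x ord0 i ^+ 2).

Definition eucl_ball (R : realType) (n : nat) (x : 'rV[R]_n) (r : R) :
    set 'rV[R]_n :=
  [set y | eucl_norm (y - x) < r].

Definition boundary (T : topologicalType) (A : set T) : set T :=
  closure A `\` interior A.

(* Only meaningful when A is nonempty. *)
Definition eucl_dist (R : realType) (n : nat) (x : 'rV[R]_n)
    (A : set 'rV[R]_n) : R :=
  inf [set eucl_norm (x - y) | y in A].

Definition eucl_diam (R : realType) (n : nat) (A : set 'rV[R]_n) : R :=
  sup [set eucl_norm (p.1 - p.2) | p in A `*` A].

(* Hausdorff measure, without a dimensional normalizing factor (irrelevant for
   finiteness).  The empty set costs 0 for every exponent s, including s = 0. *)
Definition hausdorff_gauge (R : realType) (n : nat) (s : R)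
    (U : set 'rV[R]_n) : \bar R :=
  if U == set0 then 0%E else (eucl_diam U `^ s)%:E.

Definition hausdorff_pre (R : realType) (n : nat) (s d : R)
    (A : set 'rV[R]_n) : \bar R :=
  ereal_inf
    [set (\sum_(0 <= k <oo) hausdorff_gauge s (U k))%E
    | U in [set U : nat -> set 'rV[R]_n |
        A `<=` \bigcup_k U k /\
        forall k x y, U k x -> U k y -> eucl_norm (x - y) <= d]].

Definition hausdorff (R : realType) (n : nat) (s : R) (A : set 'rV[R]_n) :
    \bar R :=
  ereal_sup [set hausdorff_pre s d A | d in [set d : R | 0 < d]].

Definition partial (R : realType) (n : nat) (i : 'I_n) (f : 'rV[R]_n -> R) :
    'rV[R]_n -> R :=
  'D_(delta_mx ord0 i) f.

Definition partials (R : realType) (n : nat) (s : seq 'I_n)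
    (f : 'rV[R]_n -> R) : 'rV[R]_n -> R :=
  foldr (@partial R n) f s.

(* C^k on the open set U: all iterated partial derivatives of order at most k
   exist and are continuous at every point of U. *)
Definition Ck (R : realType) (n k : nat) (U : set 'rV[R]_n)
    (f : 'rV[R]_n -> R) : Prop :=
  forall s : seq 'I_n, (size s <= k)%N -> forall x, U x ->
    {for x, continuous (partials s f)} /\
    ((size s < k)%N -> forall i, derivable (partials s f) x (delta_mx ord0 i)).

Definition smooth (R : realType) (n : nat) (f : 'rV[R]_n -> R) : Prop :=
  forall k, Ck k setT f.

(* Bounded domain with C^oo boundary: near each boundary point, after
   relabelling and possibly reversing one coordinate, the set is the strict
   epigraph of a smooth function g of the remaining coordinates [col' i y]. *)
Definition bounded_smooth_domain (R : realType) (n : nat) (Om : set 'rV[R]_n) :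
    Prop :=
  [/\ open Om, connected Om, Om !=set0, bounded_set Om &
      forall x0, boundary Om x0 ->
        exists r, 0 < r /\ exists (i : 'I_n) (b : bool) (g : 'rV[R]_n.-1 -> R),
          smooth g /\
          forall y, eucl_ball x0 r y ->
            (Om y <-> g (col' i y) < (-1) ^+ b * y ord0 i)].

Definition compactly_contained (R : realType) (n : nat)
    (A Om : set 'rV[R]_n) : Prop :=
  compact (closure A) /\ closure A `<=` Om.

Definition inf_laplacian (R : realType) (n : nat) (f : 'rV[R]_n -> R)
    (x : 'rV[R]_n) : R :=
  \sum_(i < n) \sum_(j < n)
    partial i (partial j f) x * partial i f x * partial j f x.

Definition C2_near (R : realType) (n : nat) (x : 'rV[R]_n)
    (f : 'rV[R]_n -> R) : Prop :=
  exists U, open_nbhs x U /\ Ck 2 U f.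

(* Delta_oo w <= F(w) in Om, in the viscosity sense. *)
Definition visc_super (R : realType) (n : nat) (Om : set 'rV[R]_n) (F : R -> R)
    (w : 'rV[R]_n -> R) : Prop :=
  forall x0 f, Om x0 -> C2_near x0 f ->
    (\forall y \near x0, w x0 - f x0 <= w y - f y) ->
    inf_laplacian f x0 <= F (w x0).

(* Delta_oo w >= F(w) in Om, in the viscosity sense. *)
Definition visc_sub (R : realType) (n : nat) (Om : set 'rV[R]_n) (F : R -> R)
    (w : 'rV[R]_n -> R) : Prop :=
  forall x0 f, Om x0 -> C2_near x0 f ->
    (\forall y \near x0, w y - f y <= w x0 - f x0) ->
    F (w x0) <= inf_laplacian f x0.

(* w in C(closure Om), Delta_oo w = F(w) in Om, w = phi on the boundary. *)
Definition dirichlet_solution (R : realType) (n : nat) (Om : set 'rV[R]_n)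
    (phi : 'rV[R]_n -> R) (F : R -> R) (w : 'rV[R]_n -> R) : Prop :=
  [/\ {within closure Om, continuous w}, visc_super Om F w, visc_sub Om F w &
      forall x, boundary Om x -> w x = phi x].

Definition alpha (R : realType) (gamma : R) : R := 4 / (3 + gamma).

Definition delta (R : realType) (gamma : R) : R :=
  2^-1 * alpha gamma `^ (- (4 / (3 + gamma))).

Definition cutoff (R : realType) (gamma : R) (B : R -> R) : Prop :=
  [/\ exists L : R, L.-lipschitz B,
      forall s, 0 <= B s <= 1,
      forall s, s <= delta gamma / 2 -> B s = 0 &
      forall s, delta gamma <= s -> B s = 1].

(* s |-> B_e(s) s^(-gamma).  The case split implements the convention that the
   product is 0 for s <= (delta/2) e^alpha; powR alone would not make s^(-gamma)
   meaningful for s <= 0. *)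
Definition penalization (R : realType) (gamma : R) (B : R -> R) (e s : R) : R :=
  if s <= delta gamma / 2 * e `^ alpha gamma then 0
  else B (s / e `^ alpha gamma) * s `^ (- gamma).

Definition lower_barrier (R : realType) (n : nat) (Om : set 'rV[R]_n)
    (phi : 'rV[R]_n -> R) (gamma e : R) (w : 'rV[R]_n -> R) : Prop :=
  dirichlet_solution Om phi
    (fun=> (delta gamma / 2) `^ (- gamma) * e `^ (- (alpha gamma * gamma))) w.

Definition upper_barrier (R : realType) (n : nat) (Om : set 'rV[R]_n)
    (phi : 'rV[R]_n -> R) (w : 'rV[R]_n -> R) : Prop :=
  dirichlet_solution Om phi (fun=> 0) w.

Definition admissible (R : realType) (n : nat) (Om : set 'rV[R]_n) (gamma : R)
    (B : R -> R) (e : R) (ul uu : 'rV[R]_n -> R) : set ('rV[R]_n -> R) :=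
  [set w | [/\ {within closure Om, continuous w},
               visc_super Om (penalization gamma B e) w &
               forall x, closure Om x -> ul x <= w x <= uu x]].

(* v is the minimal (Perron) solution of (P_e).  The barriers are unique as
   solutions of their Dirichlet problems.  Taking the infimum in \bar R forces
   the admissible family to be nonempty. *)
Definition minimal_solution (R : realType) (n : nat) (Om : set 'rV[R]_n)
    (phi : 'rV[R]_n -> R) (gamma : R) (B : R -> R) (e : R)
    (v : 'rV[R]_n -> R) : Prop :=
  exists ul uu : 'rV[R]_n -> R,
    [/\ lower_barrier Om phi gamma e ul, upper_barrier Om phi uu &
        forall x, closure Om x ->
          (v x)%:E =
          ereal_inf [set (w x)%:E | w in admissible Om gamma B e ul uu]].

(* Functions on Om are represented by total functions whose values outside Om
   are never used. *)
Definition limit_perron_solution (R : realType) (n : nat) (Om : set 'rV[R]_n)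
    (phi : 'rV[R]_n -> R) (gamma : R) (B : R -> R) (u : 'rV[R]_n -> R) : Prop :=
  exists (e : nat -> R) (v : nat -> 'rV[R]_n -> R),
    [/\ forall k, 0 < e k,
        e @ \oo --> (0 : R),
        forall k, minimal_solution Om phi gamma B (e k) (v k) &
        forall K : set 'rV[R]_n, compact K -> K `<=` Om ->
          {uniform K, v @ \oo --> u}].

Definition pos_set (R : realType) (n : nat) (Om : set 'rV[R]_n)
    (u : 'rV[R]_n -> R) : set 'rV[R]_n :=
  [set x | Om x /\ 0 < u x].

(* The boundary of {u > 0} relative to Om (Om being open). *)
Definition free_boundary (R : realType) (n : nat) (Om : set 'rV[R]_n)
    (u : 'rV[R]_n -> R) : set 'rV[R]_n :=
  boundary (pos_set Om u) `&` Om.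

(* Supremum of u, a function on Om, over B_r(x). *)
Definition sup_ball (R : realType) (n : nat) (Om : set 'rV[R]_n)
    (u : 'rV[R]_n -> R) (x : 'rV[R]_n) (r : R) : \bar R :=
  ereal_sup [set (u y)%:E | y in eucl_ball x r `&` Om].

Definition nondegeneracy_constant (R : realType) (n : nat) (Om : set 'rV[R]_n)
    (gamma : R) (u : 'rV[R]_n -> R) (c : R) : Prop :=
  forall x r, closure (pos_set Om u) x -> Om x ->
    0 < r -> r <= 2^-1 * eucl_dist x (boundary Om) ->
    ((c * r `^ alpha gamma)%:E <= sup_ball Om u x r)%E.

Definition growth_constants (R : realType) (n : nat) (Om Om' : set 'rV[R]_n)
    (gamma : R) (u : 'rV[R]_n -> R) (C r0 : R) : Prop :=
  forall x r, free_boundary Om u x -> Om' x ->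
    0 < r -> r <= r0 ->
    (sup_ball Om u x r <= (C * r `^ alpha gamma)%:E)%E.

(* Main.v *)
(** Nondegeneracy and optimal growth make the part of the free boundary in
    [Om'] porous: every small ball B_r(x) centred on it contains a point at
    distance at least [tau * r] from it.  Let E be a bounded set which is porous
    with constant t, for the sup norm, and E_d its d-neighbourhood.  On the
    segment from a point of E to a hole of radius d, within distance d / t, some
    ball of radius comparable to d lies in E_d but outside E_(d/2).  Hence
    |E_(d/2)| <= (1 - c t^n) |E_d| at all small scales d, and iterating gives
    |E_d| <= C d^(c t^n), which bounds the number of cubes of side d needed to
    cover E.  Comparing only two consecutive scales, instead of a scale and its
    multiple by t, avoids the factor 1 / log (1/t) of the cube-subdivision
    argument.  Volumes are replaced by numbers of points of a fine cubic lattice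
    whose mesh is the size of the final covering. *)

Require Import Defs.
From mathcomp Require Import all_boot all_order all_algebra.
From mathcomp Require Import all_classical all_reals all_analysis.
From mathcomp Require Import zify lra ring.

Import Order.TTheory GRing.Theory Num.Theory.
Import numFieldNormedType.Exports.

Local Open Scope classical_set_scope.
Local Open Scope ring_scope.

(** * Counting in finite types *)

Lemma double_counting {T : finType} {A D : {set T}} {e : rel T} {p q : nat} :
  (forall a, a \in A -> (p <= #|[set b in D | e a b]%SET|)%N) ->
  (forall b, b \in D -> (#|[set a in A | e a b]%SET| <= q)%N) ->
  (#|A| * p <= #|D| * q)%N.
Proof.
move=> lo up; rewrite -!sum_nat_const.
apply: leq_trans (leq_sum _ lo) _ => //.
apply: leq_trans (leq_sum _ up) => //.
rewrite (eq_bigr (fun a => \sum_(b in D) e a b)%N); last first.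
  move=> a _; rewrite -sum1_card big_mkcond [RHS]big_mkcond /=.
  by apply: eq_bigr => b _; rewrite inE; case: (b \in D); case: (e a b).
rewrite exchange_big leq_eqVlt; apply/orP; left; apply/eqP.
apply: eq_bigr => b _; rewrite -sum1_card big_mkcond [RHS]big_mkcond /=.
by apply: eq_bigr => a _; rewrite inE; case: (a \in A); case: (e a b).
Qed.

Lemma card_ffun_family (n M : nat) (F : 'I_n -> pred 'I_M) :
  #|[set q : {ffun 'I_n -> 'I_M} | [forall i, F i (q i)]]%SET| =
  (\prod_(i < n) #|F i|)%N.
Proof.
have -> : (\prod_(i < n) #|F i|)%N = foldr muln 1%N [seq #|F i| | i : 'I_n].
  by rewrite foldrE big_map big_enum.
rewrite -card_family; apply: eq_card => q; rewrite inE.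
by apply/forallP/familyP.
Qed.

Lemma card_ord_near (M b S : nat) :
  (#|[pred k : 'I_M | (k <= b + S)%N && (b <= k + S)%N]| <= 2 * S + 1)%N.
Proof.
rewrite cardE -(size_map val) -(size_iota (b - S) (2 * S + 1)).
apply: uniq_leq_size; first by rewrite map_inj_uniq ?enum_uniq //; apply: val_inj.
by move=> k /mapP [j]; rewrite mem_enum inE mem_iota => /andP[? ?] -> /=; lia.
Qed.

Lemma card_ord_itv (M k0 m : nat) (F : pred 'I_M) : (k0 + m <= M)%N ->
  (forall k : 'I_M, (k0 <= k < k0 + m)%N -> F k) -> (m <= #|F|)%N.
Proof.
move=> le FP; rewrite cardE -(size_map val) -[X in (X <= _)%N](size_iota k0 m).
apply: uniq_leq_size; first exact: iota_uniq.
move=> k; rewrite mem_iota => kP.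
have kM : (k < M)%N by lia.
by apply/mapP; exists (Ordinal kM) => //; rewrite mem_enum; apply: FP.
Qed.

(** * Sup norm against Euclidean norm *)

Section Norms.
Context {R : realType} {n : nat}.
Implicit Types x : 'rV[R]_n.

Lemma sup_normE x : `|x| = \big[Num.max/0]_ij `|x ij.1 ij.2|.
Proof. exact: mx_normrE. Qed.

Lemma sup_norm_lt {x} {r : R} : 0 < r ->
  (`|x| < r) <-> (forall i, `|x ord0 i| < r).
Proof.
move=> r0; rewrite sup_normE; split.
  move=> lt i; apply: le_lt_trans lt.
  exact: (le_bigmax _ (fun ij : 'I_1 * 'I_n => `|x ij.1 ij.2|) (ord0, i)).
by move=> H; apply: bigmax_lt => // -[i j] _ /=; rewrite ord1.
Qed.

Lemma coord_le_sup_norm x i : `|x ord0 i| <= `|x|.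
Proof.
rewrite sup_normE.
exact: (le_bigmax _ (fun ij : 'I_1 * 'I_n => `|x ij.1 ij.2|) (ord0, i)).
Qed.

Lemma sup_norm_le_eucl x : `|x| <= eucl_norm x.
Proof.
rewrite sup_normE; apply: bigmax_le; first exact: sqrtr_ge0.
move=> [i j] _ /=; rewrite ord1 /eucl_norm -sqrtr_sqr ler_wsqrtr //.
by rewrite (bigD1 j) //= lerDl sumr_ge0 // => k _; exact: sqr_ge0.
Qed.

Lemma eucl_le_sup_norm x : eucl_norm x <= n%:R * `|x|.
Proof.
have nx : 0 <= n%:R * `|x| by rewrite mulr_ge0.
rewrite -(ger0_norm nx) -sqrtr_sqr ler_wsqrtr //.
have -> : (n%:R * `|x|) ^+ 2 = \sum_(i < n) (n%:R * `|x| ^+ 2).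
  by rewrite sumr_const card_ord -mulr_natl; ring.
apply: ler_sum => i _; rewrite -(real_normK (num_real _)).
have n1 : 1 <= n%:R :> R by rewrite ler1n; have := ltn_ord i; lia.
have := coord_le_sup_norm x i; have := normr_ge0 (x ord0 i); nra.
Qed.

End Norms.

(** * Points at a prescribed distance from a set *)

(* Walking from z, where the distance to E is 0, towards a hole of radius d,
   one meets every intermediate distance s up to an error e. *)
Lemma walk_to_hole {R : realType} {V : normedModType R} {E : set V} {z y : V}
    {r d s e : R} :
  E z -> `|y - z| < r -> (forall x, E x -> d <= `|x - y|) ->
  0 < s <= d -> 0 < e ->
  exists w, [/\ `|w - z| < r, exists2 x, E x & `|w - x| < s + e &
                forall x, E x -> s <= `|w - x|].
Proof.
move=> Ez yz hole /andP[s0 sd] e0.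
pose N := (Num.truncn (`|y - z| / e)).+1.
have N0 : 0 < N%:R :> R by rewrite ltr0n.
have stepN : `|y - z| < N%:R * e.
  by rewrite -ltr_pdivrMr //; exact: truncnS_gt.
pose p (i : nat) : V := z + (i%:R / N%:R) *: (y - z).
pose far i := `[< forall x, E x -> s <= `|p i - x| >].
have farN : far N.
  apply/asboolP => x Ex; rewrite /p divff ?gt_eqF // scale1r (addrC z) subrK.
  by rewrite distrC; apply: le_trans sd (hole _ Ex).
have ex : exists i, far i by exists N.
case: (ex_minnP ex) => i /asboolP fari imin.
have iN : (i <= N)%N by apply: imin.
exists (p i); split=> //.
  rewrite /p (addrC z) addrK normrZ; apply: le_lt_trans yz.
  rewrite ler_piMl // ger0_norm ?divr_ge0 //.
  by rewrite ler_pdivrMr // mul1r ler_nat.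
(* The first far index is not 0, since [p 0 = z] lies in [E]. Its predecessor is within [s] of some
   point of [E], and one step is shorter than [e]. *)
case: i fari imin iN => [far0 _ _|i _ imin _].
  by have := far0 _ Ez; rewrite /p mul0r scale0r addr0 subrr normr0 leNgt s0.
have /asboolPn/existsNP [x /not_implyP [Ex /negP]] : ~~ far i.
  by apply/negP => /imin; rewrite ltnn.
rewrite -ltNge => lt; exists x => //.
have -> : p i.+1 - x = (p i - x) + N%:R^-1 *: (y - z).
  rewrite /p -addn1 natrD mulrDl scalerDl mul1r; rewrite addrA.
  by rewrite [RHS]addrAC.
apply: le_lt_trans (ler_normD _ _) _; apply: ltrD => //.
by rewrite normrZ ger0_norm ?invr_ge0 ?ler0n // mulrC ltr_pdivrMr // mulrC.
Qed.

(** * Counting lattice points near a set *)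

(** The cubic lattice of mesh [eta] with lowest corner [-L] in every coordinate. Indexing by a
    finite type gives its subsets a cardinal; when [2 * L <= eta * M] it spans [[-L, L]^n] up to one
    mesh. *)
Definition lattice_pt {R : realType} {n M : nat} (eta L : R)
    (q : {ffun 'I_n -> 'I_M}) : 'rV[R]_n :=
  \row_i (eta * (q i)%:R - L).

Definition lattice_nbhd {R : realType} {n : nat} (M : nat) (eta L : R)
    (E : set 'rV[R]_n) (d : R) : {set {ffun 'I_n -> 'I_M}} :=
  [set q | `[< exists2 z, E z & `|lattice_pt eta L q - z| < d >]]%SET.

Lemma lattice_nbhdP {R : realType} {n : nat} (M : nat) (eta L : R)
    (E : set 'rV[R]_n) (d : R) (q : {ffun 'I_n -> 'I_M}) :
  reflect (exists2 z, E z & `|lattice_pt eta L q - z| < d)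
          (q \in lattice_nbhd M eta L E d).
Proof. by rewrite inE; exact: asboolP. Qed.

(** In each coordinate the [m] indices starting at the integer part of [(w_i + L) / eta] qualify;
    the two bounds on [w] keep them between 0 and [M]. *)
Lemma lattice_near_box {R : realType} {n M : nat} (eta L : R) (w : 'rV[R]_n)
    (m : nat) :
  0 < eta -> (0 < m)%N -> (forall i, 0 <= w ord0 i + L) ->
  (forall i, w ord0 i + L + eta * m%:R <= eta * M%:R) ->
  (m ^ n <= #|[set q : {ffun 'I_n -> 'I_M} |
               (`|lattice_pt eta L q - w| < eta * m%:R)%R]%SET|)%N.
Proof.
move=> eta0 m0 wlo whi.
pose F i : pred 'I_M := fun k => `|eta * k%:R - L - w ord0 i| < eta * m%:R.
have em0 : 0 < eta * m%:R by rewrite mulr_gt0 ?ltr0n.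
have -> : [set q : {ffun 'I_n -> 'I_M} |
               `|lattice_pt eta L q - w| < eta * m%:R]%SET =
          [set q : {ffun 'I_n -> 'I_M} | [forall i, F i (q i)]]%SET.
  apply/setP => q; rewrite !inE; apply/idP/forallP => [/(sup_norm_lt em0) H i|H].
    by have := H i; rewrite /= !mxE.
  by apply/(sup_norm_lt em0) => i; have := H i; rewrite /= !mxE.
rewrite (card_ffun_family n M F).
have -> : (m ^ n = \prod_(i < n) m)%N by rewrite prod_nat_const card_ord.
apply: leq_prod => i _; pose x := (w ord0 i + L) / eta.
have x0 : 0 <= x by rewrite divr_ge0 // ltW.
have xE : w ord0 i + L = eta * x by rewrite mulrC divfK ?gt_eqF.
have /andP[kx xk] := truncn_itv x0; set k0 := Num.truncn x in kx xk *.
rewrite -natr1 in xk.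
have xM : x + m%:R <= M%:R.
  by have := whi i; rewrite xE -mulrDr ler_pM2l.
apply: (@card_ord_itv M k0 m).
  by rewrite -(ler_nat R) natrD; apply: le_trans xM; rewrite lerD2r.
move=> k /andP[k0k kk0]; rewrite /F.
have -> : eta * k%:R - L - w ord0 i = eta * (k%:R - x) by rewrite mulrBr -xE; ring.
rewrite normrM gtr0_norm // ltr_pM2l // ltr_norml.
have : k0%:R <= k%:R :> R by rewrite ler_nat.
have : k%:R + 1 <= k0%:R + m%:R :> R by rewrite natr1 -natrD ler_nat.
have : 1 <= m%:R :> R by rewrite ler1n.
by lra.
Qed.

(** Two integers less than [s] apart differ by at most the integer part of [s], which leaves
    [2 * truncn s + 1] choices per coordinate. *)
Lemma card_lattice_near {R : realType} {n M : nat} (eta L s : R)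
    (b : {ffun 'I_n -> 'I_M}) : 0 < eta -> 0 < s ->
  (#|[set a : {ffun 'I_n -> 'I_M} |
      (`|lattice_pt eta L a - lattice_pt eta L b| < eta * s)%R]%SET|
   <= (2 * Num.truncn s + 1) ^ n)%N.
Proof.
move=> eta0 s0; set S := Num.truncn s.
pose F i : pred 'I_M := fun k => (k <= b i + S)%N && (b i <= k + S)%N.
apply: (@leq_trans #|[set q : {ffun 'I_n -> 'I_M} | [forall i, F i (q i)]]%SET|).
  apply/subset_leq_card/fintype.subsetP => a; rewrite !inE.
  have es0 : 0 < eta * s by rewrite mulr_gt0.
  move/(sup_norm_lt es0) => H; apply/forallP => i /=.
  have := H i; rewrite !mxE.
  have -> : eta * (a i)%:R - L - (eta * (b i)%:R - L) =
            eta * ((a i)%:R - (b i)%:R) by ring.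
  rewrite normrM gtr0_norm // ltr_pM2l // ltr_norml => /andP[lo hi].
  have sS : s < S%:R + 1 by rewrite natr1; exact: truncnS_gt.
  apply/andP; split; rewrite -ltnS -(ltr_nat R) -natr1 natrD; lra.
rewrite (card_ffun_family n M F).
have -> : ((2 * S + 1) ^ n = \prod_(i < n) (2 * S + 1))%N.
  by rewrite prod_nat_const card_ord.
by apply: leq_prod => i _; exact: card_ord_near.
Qed.

(* Counts the pairs of a point a of the larger neighbourhood and a point b lost
   when the radius is halved, at distance less than twice the porosity scale
   r = 8 h / t, where h = eta m: each a has at least m^n partners, and each b at
   most (33 m / t)^n. *)
Lemma lattice_nbhd_halving {R : realType} {n : nat} (M : nat)
    (eta L rho t : R) (E : set 'rV[R]_n) (m : nat) :
  0 < t <= 2^-1 ->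
  (forall x (r : R), E x -> 0 < r <= rho ->
     exists y : 'rV[R]_n, `|y - x| < r /\ forall z, E z -> t * r <= `|z - y|) ->
  (forall z, E z -> `|z| + 2 * rho <= L) ->
  0 < eta -> 2 * L <= eta * M%:R ->
  (0 < m)%N -> 8 * (eta * m%:R) <= t * rho ->
  #|lattice_nbhd M eta L E (4 * (eta * m%:R))|%:R <=
  (1 - (t / 33) ^+ n) * #|lattice_nbhd M eta L E (8 * (eta * m%:R))|%:R :> R.
Proof.
move=> /andP[t0 t2] por EL eta0 LM m0 mrho.
set h := eta * m%:R in mrho *.
have h0 : 0 < h by rewrite mulr_gt0 ?ltr0n.
set A := lattice_nbhd M eta L E (8 * h).
set A' := lattice_nbhd M eta L E (4 * h).
have A'A : A' \subset A.
  apply/fintype.subsetP => q /lattice_nbhdP [z Ez zq]; apply/lattice_nbhdP.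
  by exists z => //; apply: lt_trans zq _; lra.
pose s : R := 16 * m%:R / t.
have s0 : 0 < s by rewrite divr_gt0 // mulr_gt0 ?ltr0n.
pose e := [rel a b : {ffun 'I_n -> 'I_M} |
            `|lattice_pt eta L a - lattice_pt eta L b| < eta * s].
have up b : b \in A :\: A' ->
    (#|[set a in A | e a b]%SET| <= (2 * Num.truncn s + 1) ^ n)%N.
  move=> _; apply: leq_trans (@card_lattice_near R n M eta L s b eta0 s0).
  by apply/subset_leq_card/fintype.subsetP => a; rewrite !inE => /andP[].
have lo a : a \in A -> (m ^ n <= #|[set b in A :\: A' | e a b]%SET|)%N.
  move=> /lattice_nbhdP [z Ez az].
  pose r := 8 * h / t.
  have rt : t * r = 8 * h by rewrite mulrC divfK ?gt_eqF.
  have r0 : 0 < r by rewrite divr_gt0 // mulr_gt0.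
  have rrho : r <= rho by rewrite ler_pdivrMr // (mulrC rho).
  have hr : 8 * h <= r / 2 by rewrite -rt; nra.
  have [|y [yz hole]] := por z r Ez; first by rewrite r0.
  rewrite rt in hole.
  (* Here [w] is at distance at least [5 h] and less than [6 h] from [E]. Every [b] within [h] of
     [w] is then farther than [4 h] and nearer than [7 h], hence in [A] but not in [A']. *)
  have [] := @walk_to_hole R _ E z y r (8 * h) (5 * h) h Ez yz hole => //.
    by apply/andP; split; lra.
  move=> w [wz [x Ex wx] far].
  have wz_i i : `|w ord0 i| <= `|z| + rho.
    apply: le_trans (coord_le_sup_norm w i) _.
    rewrite -(subrK z w) addrC; apply: le_trans (ler_normD _ _) _.
    by rewrite lerD2l; lra.
  have := EL _ Ez => zL.
  apply: leq_trans (@lattice_near_box R n M eta L w m eta0 m0 _ _) _.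
  - by move=> i; have := wz_i i; rewrite ler_norml => /andP[]; lra.
  - move=> i; have := wz_i i; rewrite ler_norml -/h => /andP[] ? ?.
    by lra.
  apply/subset_leq_card/fintype.subsetP => b; rewrite inE -/h => bw.
  rewrite finset.in_set finset.in_setD; apply/andP; split; first (apply/andP; split).
  - apply/lattice_nbhdP => -[x' Ex' bx']; have := far _ Ex'.
    apply/negP; rewrite -ltNge.
    have := ler_distD (lattice_pt eta L b) w x'.
    by rewrite (distrC w (lattice_pt _ _ _)); lra.
  - apply/lattice_nbhdP; exists x => //.
    have := ler_distD w (lattice_pt eta L b) x.
    by lra.
  (* The path from [a] through [z] and [w] to [b] is shorter than [8 h + r + h], and [8 h <= r / 2]
     because [t <= 1 / 2]. *)
  - rewrite /e /=.
    have -> : eta * s = 2 * r by rewrite /s /r /h; field; rewrite gt_eqF.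
    have := ler_distD z (lattice_pt eta L a) (lattice_pt eta L b).
    have := ler_distD w z (lattice_pt eta L b).
    by rewrite (distrC z w) (distrC w (lattice_pt _ _ _)); lra.
have := double_counting lo up.
set D := A :\: A'; rewrite -(ler_nat R) !natrM !natrX natrD natrM => dc.
have cA : #|A|%:R = #|A'|%:R + #|D|%:R :> R.
  by rewrite -natrD -(cardsID A' A) (finset.setIidPr A'A).
set S := Num.truncn s in dc.
have /andP[Ss _] := truncn_itv (ltW s0); rewrite -/S in Ss.
have m1 : 1 <= m%:R :> R by rewrite ler1n.
(* Origin of 33: [2 * S] is at most [32 m / t], and the remaining 1 is at most [m / t]. *)
have S33 : 2 * S%:R + 1 <= 33 * m%:R / t.
  have : m%:R <= m%:R / t by rewrite ler_peMr ?invf_ge1 //; lra.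
  by move: Ss; rewrite /s -!mulrA; lra.
have m_n : 0 < m%:R ^+ n :> R by rewrite exprn_gt0 // ltr0n.
have dc' : #|A|%:R * m%:R ^+ n <= #|D|%:R * (33 * m%:R / t) ^+ n :> R.
  have S0 : 0 <= S%:R :> R by [].
  apply: le_trans dc _; apply: ler_wpM2l => //.
  by rewrite lerXn2r // nnegrE; lra.
suff : (t / 33) ^+ n * #|A|%:R <= #|D|%:R :> R by rewrite cA; lra.
have -> : #|D|%:R = (t / 33) ^+ n * (#|D|%:R * (33 * m%:R / t) ^+ n) / m%:R ^+ n :> R.
  rewrite mulrCA -exprMn.
  have -> : t / 33 * (33 * m%:R / t) = m%:R by field; rewrite gt_eqF.
  by rewrite mulfK ?gt_eqF.
rewrite -mulrA; apply: ler_wpM2l; first by rewrite exprn_ge0 // divr_ge0 // ltW.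
by rewrite ler_pdivlMr.
Qed.

(** * Hausdorff measure of a bounded porous set *)

Lemma hausdorff_gauge_le {R : realType} {n : nat} (s D : R)
    (U : set 'rV[R]_n) :
  0 <= s -> 0 <= D -> (forall x y, U x -> U y -> eucl_norm (x - y) <= D) ->
  (0 <= hausdorff_gauge s U <= (D `^ s)%:E)%E.
Proof.
move=> s0 D0 UD; rewrite /hausdorff_gauge.
case: eqP => [_|/eqP/set0P [x Ux]]; first by rewrite lexx lee_fin powR_ge0.
rewrite !lee_fin powR_ge0 /=.
have ubD : ubound [set eucl_norm (p.1 - p.2) | p in U `*` U] D.
  by move=> _ [[a b] [/= Ua Ub] <-]; exact: UD.
apply: ge0_ler_powR => //; rewrite ?nnegrE //.
  apply: (@le_trans _ _ (eucl_norm (x - x))); first exact: sqrtr_ge0.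
  by apply: ub_le_sup; [exists D|exists (x, x)].
by apply: ge_sup => //; exists (eucl_norm (x - x)), (x, x).
Qed.

Lemma hausdorff_pre_le_finite_cover {R : realType} {n : nat} {I : finType}
    {s d D : R} {A : {set I}} {W : I -> set 'rV[R]_n} {E : set 'rV[R]_n} :
  0 <= s -> 0 <= D <= d ->
  (forall i x y, W i x -> W i y -> eucl_norm (x - y) <= D) ->
  (forall x, E x -> exists2 i, i \in A & W i x) ->
  (hausdorff_pre s d E <= (#|A|%:R * D `^ s)%:E)%E.
Proof.
move=> s0 /andP[D0 Dd] WD EW.
(* The cover as a sequence: [U k] is the piece of the [k]-th element of [A], and is empty from
   [#|A|] on, where the gauge is 0 even if [s = 0]. *)
pose U k := [set x | exists2 i, i \in A /\ index i (enum A) = k & W i x].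
have UD k x y : U k x -> U k y -> eucl_norm (x - y) <= D.
  move=> [i [iA ik] Wx] [j [jA jk] Wy]; apply: (WD i) => //.
  have iE : i \in enum A by rewrite mem_enum.
  have jE : j \in enum A by rewrite mem_enum.
  by rewrite -(nth_index i iE) ik -jk nth_index.
have gU k : (0 <= hausdorff_gauge s (U k) <= (D `^ s)%:E)%E.
  by apply: hausdorff_gauge_le => // x y; exact: UD.
apply: ge_ereal_inf; exists (\sum_(0 <= k <oo) hausdorff_gauge s (U k))%E.
  exists U => //; split.
    move=> x /EW [i iA Wx]; exists (index i (enum A)) => //.
    by exists i.
  by move=> k x y Ux Uy; apply: le_trans Dd; exact: UD Uy.
rewrite (nneseries_split 0 #|A|); last by move=> k _; case/andP: (gU k).
rewrite add0n eseries0 ?adde0; last first.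
  move=> k kA _; rewrite /hausdorff_gauge; case: eqP => // /eqP/set0P [x].
  move=> [i [iA ik] _]; move: kA; rewrite -ik cardE leqNgt index_mem.
  by rewrite mem_enum iA.
apply: (@le_trans _ _ (\sum_(0 <= k < #|A|) (D `^ s)%:E)%E).
  by apply: lee_sum => k _; case/andP: (gU k).
by rewrite sumEFin sumr_const_nat subn0 mulr_natl.
Qed.

(** Follows from [1 - s <= exp (- s)] and [ln 2 <= 1]. It says that the proportion lost in one
    halving pays for the exponent gained. *)
Lemma one_sub_mul_powR2_le1 {R : realType} (s : R) :
  0 <= s <= 1 -> (1 - s) * 2 `^ s <= 1.
Proof.
move=> /andP[s0 s1].
rewrite -[leRHS]expR0 -(addNr s) expRD.
apply: ler_pM; rewrite ?powR_ge0 ?subr_ge0 ?expR_ge1Dx //.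
rewrite /powR gt_eqF // ler_expR ler_piMr //.
by apply: (@le_ln1Dx _ 1); lra.
Qed.

Lemma hausdorff_porous {R : realType} {n : nat} (rho t L0 : R)
    (E : set 'rV[R]_n) :
  (0 < n)%N -> 0 < t <= 2^-1 -> 0 < rho ->
  (forall x (r : R), E x -> 0 < r <= rho ->
     exists y : 'rV[R]_n, `|y - x| < r /\ forall z, E z -> t * r <= `|z - y|) ->
  (forall z, E z -> `|z| <= L0) ->
  (hausdorff (n%:R - (t / 33) ^+ n) E < +oo)%E.
Proof.
move=> n0 tP rho0 por EL0; have /andP[t0 t2] := tP.
set sg := (t / 33) ^+ n.
have sg01 : 0 <= sg <= 1.
  by rewrite exprn_ge0 ?exprn_ile1 ?divr_ge0 ?ler_pdivrMr ?ltW //; lra.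
have /andP[sg0 sg1] := sg01.
have n1 : 1 <= n%:R :> R by rewrite ler1n.
set s := n%:R - sg; have s0 : 0 <= s by rewrite /s; lra.
pose L := L0 + 2 * rho.
have EL z : E z -> `|z| + 2 * rho <= L by move/EL0; rewrite lerD2r.
(* The largest value of [h = eta m] that [lattice_nbhd_halving] allows, from which the halvings
   start. *)
pose a := t * rho / 8; have a0 : 0 < a by rewrite divr_gt0 // mulr_gt0.
have arho : 8 * a <= rho by rewrite /a; nra.
pose K := (Num.truncn (2 * L / a)).+1.
have KL : 2 * L <= a * K%:R.
  by rewrite (mulrC a) -ler_pdivrMr //; exact/ltW/truncnS_gt.
(* Bounds the Euclidean diameter of a sup-norm ball of radius [a]; after [J] halvings the covering
   cubes have diameter at most [D / 2 ^ J]. *)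
pose D := 2 * n%:R * a; have D0 : 0 < D by rewrite !mulr_gt0 ?ltr0n.
suff pre (d : R) : 0 < d -> (hausdorff_pre s d E <= (K%:R ^+ n * D `^ s)%:E)%E.
  apply: (@le_lt_trans _ _ (K%:R ^+ n * D `^ s)%:E); last exact: ltry.
  by apply: ge_ereal_sup => _ [d /= d0 <-]; exact: pre.
(* Since [J + 1 <= 2 ^ J], this many halvings bring the diameters below [d]. *)
move=> d0; pose J := Num.truncn (D / d); pose X : R := 2 ^+ J.
have X0 : 0 < X by rewrite exprn_gt0.
have X1 : 1 <= X by rewrite exprn_ege1 // ler1n.
have DX : D / X <= d.
  rewrite ler_pdivrMr // mulrC -ler_pdivrMr //.
  apply: le_trans (ltW (truncnS_gt _)) _.
  by rewrite /X -natrX ler_nat ltn_expl.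
pose eta := a / X; have eta0 : 0 < eta by rewrite divr_gt0.
have etaX : eta * X = a by rewrite divfK ?gt_eqF.
have etaa : eta <= a by rewrite ler_pdivrMr // ler_peMr // ltW.
pose M := (K * 2 ^ J)%N.
have LM : 2 * L <= eta * M%:R.
  by rewrite natrM natrX -/X mulrCA etaX (mulrC _ a).
(* [V J] has radius [8 a] and [V 0] radius [8 eta], so [J] halvings lead from the coarse scale to
   the mesh. *)
pose V j := lattice_nbhd M eta L E (8 * (eta * (2 ^ j)%:R)).
have halve j : (j < J)%N -> #|V j|%:R <= (1 - sg) * #|V j.+1|%:R :> R.
  move=> jJ; rewrite /V.
  have -> : 8 * (eta * (2 ^ j)%:R) = 4 * (eta * (2 ^ j.+1)%:R) :> R.
    by rewrite expnS natrM; ring.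
  apply: (@lattice_nbhd_halving R n M eta L rho t) => //.
    by rewrite expn_gt0.
  have -> : t * rho = 8 * a by rewrite /a; field.
  rewrite ler_pM2l // -etaX ler_pM2l // /X -natrX ler_nat.
  by rewrite leq_exp2l.
have VJ j : (j <= J)%N -> #|V 0%N|%:R <= (1 - sg) ^+ j * #|V j|%:R :> R.
  elim: j => [_|j IH jJ]; first by rewrite expr0 mul1r.
  apply: le_trans (IH (ltnW jJ)) _; rewrite exprSr -mulrA.
  by apply: ler_wpM2l (halve _ jJ); rewrite exprn_ge0 // subr_ge0.
have V0 : #|V 0%N|%:R <= (1 - sg) ^+ J * (K%:R * X) ^+ n :> R.
  apply: le_trans (VJ _ (leqnn J)) _; apply: ler_wpM2l.
    by rewrite exprn_ge0 // subr_ge0.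
  rewrite /X -natrX -natrM -natrX ler_nat; apply: leq_trans (max_card _) _.
  by rewrite card_ffun !card_ord.
pose W (q : {ffun 'I_n -> 'I_M}) :=
  [set x : 'rV[R]_n | `|lattice_pt eta L q - x| <= eta].
have WD q x y : W q x -> W q y -> eucl_norm (x - y) <= D / X.
  rewrite /W /= => Wx Wy; apply: le_trans (eucl_le_sup_norm _) _.
  have -> : D / X = n%:R * (2 * eta) by rewrite /D /eta; ring.
  apply: ler_wpM2l => //.
  have := ler_distD (lattice_pt eta L q) x y.
  by rewrite (distrC x (lattice_pt _ _ _)); lra.
have EW x : E x -> exists2 q, q \in V 0%N & W q x.
  move=> Ex; have xL := EL _ Ex.
  have x_i i : `|x ord0 i| + 2 * rho <= L.
    by apply: le_trans xL; rewrite lerD2r coord_le_sup_norm.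
  have := @lattice_near_box R n M eta L x 1 eta0 isT.
  rewrite exp1n card_gt0 => /(_ _ _)/finset.set0Pn [|i|q].
  - by move=> i; have := x_i i; have := ler_norm (- x ord0 i);
       rewrite normrN; lra.
  - by have := x_i i; have := ler_norm (x ord0 i); lra.
  rewrite inE mulr1 => qx; exists q; last exact: ltW.
  apply/lattice_nbhdP; exists x => //; apply: lt_trans qx _.
  by rewrite expn0 mulr1; lra.
have DX0 : 0 <= D / X <= d by rewrite DX divr_ge0 // ltW.
apply: le_trans (hausdorff_pre_le_finite_cover s0 DX0 WD EW) _.
rewrite lee_fin.
(* As [s = n - sg], at most [(1 - sg) ^ J (K X) ^ n] cubes of cost [(D / X) ^ s] leave the factor
   [X ^ sg = (2 ^ sg) ^ J], which [(1 - sg) ^ J] absorbs. *)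
have XE : X ^+ n * X^-1 `^ s = X `^ sg.
  rewrite -(powR_inv1 (ltW X0)) -powRrM mulN1r -powR_mulrn ?ltW //.
  rewrite -powRD; last by rewrite (gt_eqF X0) implybT.
  by congr (_ `^ _); rewrite /s; ring.
have XJ : X `^ sg = (2 `^ sg) ^+ J.
  rewrite /X -(powR_mulrn J (ler0n R 2)) -powRrM mulrC powRrM.
  by rewrite powR_mulrn ?powR_ge0.
have iX0 : 0 <= X^-1 by rewrite invr_ge0 ltW.
rewrite (powRM s (ltW D0) iX0).
apply: (@le_trans _ _ ((1 - sg) ^+ J * (K%:R * X) ^+ n * (D `^ s * X^-1 `^ s))).
  by apply: ler_wpM2r V0; rewrite mulr_ge0 // powR_ge0.
have -> : (1 - sg) ^+ J * (K%:R * X) ^+ n * (D `^ s * X^-1 `^ s) =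
    ((1 - sg) * 2 `^ sg) ^+ J * (K%:R ^+ n * D `^ s).
  by rewrite [in RHS]exprMn -XJ -XE exprMn; ring.
rewrite ler_piMl ?mulr_ge0 ?exprn_ge0 ?powR_ge0 //.
by rewrite exprn_ile1 ?one_sub_mul_powR2_le1 // mulr_ge0 ?powR_ge0 ?subr_ge0.
Qed.

(** * Geometry of the domain and porosity of the free boundary *)

(** Keeps the distance to [boundary Om] from being an infimum over the empty set. With no boundary
    [Om] would be clopen, so a line through one of its points would stay in it, against
    boundedness. *)
Lemma boundary_nonempty {R : realType} {n : nat} {Om : set 'rV[R]_n} :
  (0 < n)%N -> open Om -> Om !=set0 -> bounded_set Om -> boundary Om !=set0.
Proof.
move=> n0 oOm [x0 Omx0] [M [_ bOm]]; apply/set0P/negP => /eqP bd0.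
have cOm : closed Om.
  move=> x clx; rewrite -(interior_id Om).1 //.
  apply: contrapT => nint.
  by have : boundary Om x by []; rewrite bd0.
pose v : 'rV[R]_n := const_mx 1.
pose f (s : R) : 'rV[R]_n := x0 + s *: v.
have cf : continuous f.
  by move=> s; apply: cvgD; [exact: cvg_cst | apply: cvgZr_tmp; exact: cvg_id].
have [oS cS] : clopen (f @^-1` Om) by apply: preimage_clopen.
have : connected [set: R] by apply/connected_intervalP => x y _ _ z _.
move=> /(_ (f @^-1` Om)) ST.
have {}ST : f @^-1` Om = setT.
  apply: ST; first by exists 0; rewrite /preimage /= /f scale0r addr0.
  - by exists (f @^-1` Om); rewrite ?setTI.
  - by exists (f @^-1` Om); rewrite ?setTI.
pose i : 'I_n := Ordinal n0.
pose s := `|M| + 1 - x0 ord0 i + 1.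
have : Om (f s) by have : (f @^-1` Om) s by rewrite ST.
move=> /(bOm (`|M| + 1)); rewrite ltNge.
have -> : (`|M| + 1 <= M) = false.
  by apply/negbTE; rewrite -ltNge; have := ler_norm M; lra.
move=> /(_ isT); apply/negP; rewrite -ltNge.
apply: lt_le_trans (coord_le_sup_norm (f s) i).
apply: lt_le_trans (ler_norm _).
by rewrite /f !mxE /s mulr1; lra.
Qed.

(** Around a point with a ball of radius [e] inside [Om], half of [e] is a margin for the whole ball
    of radius [e / 2]; compactness makes the margin uniform. *)
Lemma compactly_contained_margin {R : realType} {n : nat}
    {A Om : set 'rV[R]_n} :
  open Om -> compactly_contained A Om ->
  exists2 e : R, 0 < e & forall x y, A x -> ~ Om y -> e <= `|x - y|.
Proof.
move=> oOm [/compact_near_coveringP cA AOm].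
have : \forall e \near (0 : R)^'+,
    closure A `<=` [set x | forall y, ~ Om y -> e <= `|x - y|].
  apply: (cA _ _ (fun e x => forall y, ~ Om y -> e <= `|x - y|)) => x Ax.
  have /nbhs_ballP [e /= e0 eOm] : nbhs x Om.
    by apply: open_nbhs_nbhs; split=> //; exact: AOm.
  exists (ball x (e / 2), [set d : R | d < e / 2]) => /=.
    split; first by apply: nbhsx_ballx; rewrite divr_gt0.
    by apply: nbhs_right_lt; rewrite divr_gt0.
  move=> [x' d] [/= xx' de] y nOmy; rewrite leNgt; apply/negP => x'y.
  apply: nOmy; apply: eOm; rewrite (splitr e).
  apply: ball_triangle xx' _.
  rewrite -ball_normE /=; exact: lt_trans de.
move=> H.
near (0 : R)^'+ => e.
exists e => // x y Ax; apply: (near H e) => //.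
exact: subset_closure.
Unshelve. all: by end_near.
Qed.

(* Nondegeneracy gives a point y of B_r(x) with u y > C (tau r)^alpha; by the
   growth bound no free boundary point of Om' is within tau r of y. *)
Lemma free_boundary_porous {R : realType} {n : nat} {Om Om' : set 'rV[R]_n}
    {gamma : R} {u : 'rV[R]_n -> R} {c C r0 tau : R} {x : 'rV[R]_n} {r : R} :
  0 < alpha gamma -> 0 < c -> 0 < C -> 0 < tau <= 1 ->
  tau < (c / C) `^ (1 / alpha gamma) ->
  nondegeneracy_constant Om gamma u c ->
  growth_constants Om Om' gamma u C r0 ->
  free_boundary Om u x -> 0 < r <= r0 ->
  r <= 2^-1 * eucl_dist x (boundary Om) ->
  exists2 y, eucl_norm (y - x) < r &
    forall z, (free_boundary Om u `&` Om') z -> tau * r <= eucl_norm (y - z).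
Proof.
move=> al0 c0 C0 /andP[tau0 tau1] tauC nd gr [[clx _] Omx] /andP[r0' rr0] rd.
have lt : C * (tau * r) `^ alpha gamma < c * r `^ alpha gamma.
  rewrite powRM ?ltW // mulrA ltr_pM2r ?powR_gt0 // mulrC -ltr_pdivlMr //.
  have -> : c / C = ((c / C) `^ (1 / alpha gamma)) `^ alpha gamma.
    by rewrite -powRrM divfK ?gt_eqF // powRr1 // ltW // divr_gt0.
  by apply: gt0_ltr_powR; rewrite // nnegrE ?powR_ge0 // ltW.
have : ((C * (tau * r) `^ alpha gamma)%:E < sup_ball Om u x r)%E.
  by apply: lt_le_trans (nd x r clx Omx r0' rd); rewrite lte_fin.
move=> /ereal_sup_gt [_ [y [yx Omy] <-] uy]; exists y => //.
move=> z [fz Oz]; rewrite leNgt; apply/negP => yz.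
have tr0 : 0 < tau * r by rewrite mulr_gt0.
have := gr z (tau * r) fz Oz tr0; rewrite (le_trans _ rr0); last first.
  by rewrite ler_piMl // ltW.
move=> /(_ isT); apply/negP; rewrite -ltNge; apply: lt_le_trans uy _.
by apply: ereal_sup_ubound; exists y.
Qed.

Theorem mainTheorem7 (R : realType) (n : nat) (n_gt0 : (0 < n)%N) :
  exists eps : R, 0 < eps /\
  forall (gamma : R) (B : R -> R) (Om Om' : set 'rV[R]_n)
         (phi u : 'rV[R]_n -> R) (c C r0 tau : R),
    0 <= gamma < 1 ->
    cutoff gamma B ->
    bounded_smooth_domain Om ->
    smooth phi ->
    (forall x, boundary Om x -> 0 <= phi x) ->
    limit_perron_solution Om phi gamma B u ->
    compactly_contained Om' Om ->
    0 < c -> nondegeneracy_constant Om gamma u c ->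
    0 < C -> 0 < r0 -> growth_constants Om Om' gamma u C r0 ->
    0 < tau < Num.min (1 / 2) ((c / C) `^ (1 / alpha gamma)) ->
    (hausdorff (n%:R - eps * tau ^+ n) (free_boundary Om u `&` Om') < +oo)%E.
Proof.
(* The 33 comes from [hausdorff_porous]. The [n] comes from the change of norm: a Euclidean hole of
   radius [tau * r] is a sup-norm hole of radius [tau * r / n]. *)
exists ((33 * n%:R)^-1 ^+ n).
have n0 : 0 < n%:R :> R by rewrite ltr0n.
split; first by rewrite exprn_gt0 // invr_gt0 mulr_gt0.
move=> gamma B Om Om' phi u c C r0 tau /andP[ga0 ga1] _ [oOm _ neOm bOm _].
move=> _ _ _ cc c0 nd C0 r00 gr /andP[tau0]; rewrite lt_min => /andP[tau2 tauC].
have n1 : 1 <= n%:R :> R by rewrite ler1n.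
have al0 : 0 < alpha gamma by rewrite /alpha divr_gt0 //; lra.
have [e e0 eP] := compactly_contained_margin oOm cc.
have [b0 bd0] := boundary_nonempty n_gt0 oOm neOm bOm.
have bdOm b : boundary Om b -> ~ Om b.
  by move=> [_ nint] Omb; apply: nint; rewrite (interior_id Om).1.
have dist x : Om' x -> e <= eucl_dist x (boundary Om).
  move=> Ox; apply: lb_le_inf; first by exists (eucl_norm (x - b0)), b0.
  move=> _ [b /bdOm nb <-]; apply: le_trans (eP x b Ox nb) _.
  exact: sup_norm_le_eucl.
(* Radii up to [r0] allow the growth bound; radii up to [e / 2] are at most half the distance to the
   boundary, as nondegeneracy requires. *)
pose rho := Num.min r0 (e / 2).
have rho0 : 0 < rho by rewrite lt_min r00 divr_gt0.
have [M [_ bM]] := bOm.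
have -> : (33 * n%:R)^-1 ^+ n * tau ^+ n = (tau / n%:R / 33) ^+ n.
  by rewrite -exprMn; congr (_ ^+ n); field; rewrite gt_eqF.
apply: (@hausdorff_porous R n rho (tau / n%:R) (`|M| + 1)) => //.
- by rewrite divr_gt0 //= ler_pdivrMr //; nra.
- move=> x r [fx Ox] /andP[r0' rrho].
  have rr0 : r <= r0 by apply: le_trans rrho _; rewrite ge_min lexx.
  have re : r <= e / 2 by apply: le_trans rrho _; rewrite ge_min lexx orbT.
  have tau01 : 0 < tau <= 1 by rewrite tau0; lra.
  have rr : 0 < r <= r0 by rewrite r0'.
  have rd : r <= 2^-1 * eucl_dist x (boundary Om) by have := dist x Ox; lra.
  have [y yx hole] := free_boundary_porous al0 c0 C0 tau01 tauC nd gr fx rr rd.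
  exists y; split; first by apply: le_lt_trans yx; exact: sup_norm_le_eucl.
  move=> z Ez; rewrite mulrAC ler_pdivrMr // (mulrC _ n%:R) distrC.
  exact: le_trans (hole z Ez) (eucl_le_sup_norm _).
- move=> z [[_ Omz] _]; apply: (bM (`|M| + 1)) => //.
  by have := ler_norm M; lra.
Qed.
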